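(* Let $H$ be a linear $3$-uniform hypergraph on $n\ge 6$ vertices that is linear Berge-$C_4$-saturated and disconnected. Then for every connected component $H'$ of $H$ with $n'$ vertices, $$e(H')\geq \begin{cases} 0, &\text{ when } \delta(H')= 0;\\ \frac{2n'}{3} -2, &\text{ when } \delta(H')= 1;\\ \frac{13n'-29}{18}, &\text{ when } \delta(H') = 2;\\ n', &\text{ when } \delta(H')\ge 3. \end{cases}$$ Furthermore, $e(H)\ge \frac{2n}{3}-4$.
   Context: A hypergraph $H=(V(H),E(H))$ is $3$-uniform if every hyperedge is a $3$-element subset of $V(H)$, and linear if any two distinct hyperedges share at most one vertex. $e(H)$ denotes the number of hyperedges, the degree of a vertex is the number of hyperedges containing it, and $\delta(H')$ is the minimum vertex degree of $H'$. Connectivity and components are the usual ones for hypergraphs (an isolated vertex forms a component). A Berge cycle Berge-$C_\ell$ of length $\ell$ in $H$ is an alternating sequence $(v_1,e_1,v_2,e_2,\dots,v_\ell,e_\ell)$ of distinct vertices $v_i$ and distinct hyperedges $e_i$ of $H$ with $v_i,v_{i+1}\in e_i$ for $1\le i\le \ell-1$ and $v_\ell,v_1\in e_\ell$. A linear $3$-uniform hypergraph $H$ is linear Berge-$C_4$-saturated if $H$ contains no Berge-$C_4$, but for every $e\in\binom{V(H)}{3}\setminus E(H)$ such that $H+e$ is still linear, $H+e$ contains a Berge-$C_4$. *)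

(* Defs.v *)
From mathcomp Require Import all_boot.

Set Implicit Arguments.
Unset Strict Implicit.
Unset Printing Implicit Defensive.

Section Hypergraphs.

Variable T : finType.

(* T is an ambient type, so that a hypergraph, its components and H + e can
   have different vertex sets while sharing one type. *)
Record hypergraph := Hypergraph {
  vertices : {set T};
  edges : {set {set T}};
  edges_sub : edges \subset powerset vertices
}.

Implicit Types (H : hypergraph) (e f C : {set T}) (x y v : T).

Definition uniform (k : nat) H : Prop := {in edges H, forall e, #|e| = k}.

Definition linear_hypergraph H : Prop :=
  {in edges H &, forall e f, e != f -> #|e :&: f| <= 1}.

Definition degree H v : nat := #|[set e in edges H | v \in e]|.

(* Every degree is at most #|edges H|, so the default value of the iterated
   minimum matters only when there are no vertices. *)
Definition min_degree H : nat :=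
  \big[minn/#|edges H|]_(v in vertices H) degree H v.

(* ordS is the cyclic successor on 'I_l. *)
Definition has_berge_cycle (l : nat) H : Prop :=
  exists (v : 'I_l -> T) (e : 'I_l -> {set T}),
    [/\ injective v, injective e &
        forall i : 'I_l, [/\ e i \in edges H, v i \in e i & v (ordS i) \in e i]].

Fact add_edge_sub H e : e |: edges H \subset powerset (vertices H :|: e).
Proof.
apply/subsetP=> f; rewrite !inE => /orP[/eqP-> | fH]; first exact: subsetUr.
have /subsetP/(_ f fH) := edges_sub H.
by rewrite inE => /subset_trans; apply; apply: subsetUl.
Qed.

(* H + e; the vertex set is unchanged when e \subset vertices H. *)
Definition add_edge H e : hypergraph := Hypergraph (add_edge_sub H e).

Definition linear_berge_saturated (l : nat) H : Prop :=
  ~ has_berge_cycle l H /\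
  forall e, e \subset vertices H -> #|e| = 3 -> e \notin edges H ->
    linear_hypergraph (add_edge H e) -> has_berge_cycle l (add_edge H e).

Definition adjacent H : rel T :=
  fun x y => [exists e in edges H, (x \in e) && (y \in e)].

Definition connected H : Prop :=
  {in vertices H &, forall x y, connect (adjacent H) x y}.

Fact induced_sub H C :
  [set e in edges H | e \subset C] \subset powerset C.
Proof. by apply/subsetP=> e; rewrite !inE => /andP[]. Qed.

Definition induced H C : hypergraph := Hypergraph (induced_sub H C).

Definition is_component H (H' : hypergraph) : Prop :=
  exists2 x, x \in vertices H &
    H' = induced H [set y in vertices H | connect (adjacent H) x y].

End Hypergraphs.

(* Main.v *)
Require Import Defs.
From mathcomp Require Import all_boot all_order all_algebra.
From mathcomp Require Import zify lra.

Set Implicit Arguments.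
Unset Strict Implicit.
Unset Printing Implicit Defensive.

(* A triple made of two nonadjacent vertices of one component and a vertex
   outside it can be added, so saturation forces every two distinct vertices of
   a component to be adjacent or joined by a Berge path with three edges;
   likewise there cannot be three components.
   If the component has a vertex of degree 2, every vertex is at distance at
   most 3 from it, and breadth-first search gives
   n' <= 29 + 6 sum (d(v) - 2) = 29 + 6 (3 e' - 2 n').
   For 3 e' >= 2 n' - 6, that is sum (2 - d(v)) <= 6, the unit deficit of each
   degree-1 vertex (leaf) is discharged to the other vertices of its edge.  Any
   two leaf edges are linked by a third edge, so C4-freeness makes almost every
   vertex able to pay; the overdrawn ones ([core]) are pairwise adjacent, and
   cliques have at most 5 vertices.  A vertex overdrawn by two units ([full]) is
   the only core. *)

(** * Distinctness of short lists, and Berge paths with three edges *)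

Lemma uniq3E (T : eqType) (a b c : T) :
  uniq [:: a; b; c] = [&& a != b, a != c & b != c].
Proof. by rewrite /= !inE !negb_or andbT -andbA. Qed.

Lemma uniq4E (T : eqType) (a b c d : T) :
  uniq [:: a; b; c; d] = [&& a != b, a != c, a != d, b != c, b != d & c != d].
Proof. by rewrite /= !inE !negb_or andbT -!andbA. Qed.

Lemma uniq_leq_card (T : finType) (A : {set T}) (s : seq T) :
  uniq s -> all [in A] s -> size s <= #|A|.
Proof.
move=> Us /allP sA; rewrite cardE; apply: uniq_leq_size => // x /sA.
by rewrite mem_enum.
Qed.

(** A Berge path with three edges; an additional edge through [x] and [y] closes it to a
    Berge-C4. *)
Definition linked3 (T : finType) (H : hypergraph T) (x y : T) : Prop :=
  exists a b e f g,
  [/\ uniq [:: x; a; b; y], uniq [:: e; f; g],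
      [/\ e \in edges H, f \in edges H & g \in edges H],
      [/\ x \in e, a \in e, a \in f & b \in f] & b \in g /\ y \in g].

(** * Edges and degrees in a linear 3-uniform hypergraph *)

Section Linear.

Variables (T : finType) (H : hypergraph T).
Hypotheses (unif : uniform 3 H) (lin : linear_hypergraph H).

Implicit Types (x y z v w a b c : T) (e f g h m : {set T}).

Lemma adjacentP x y :
  reflect (exists e, [/\ e \in edges H, x \in e & y \in e]) (adjacent H x y).
Proof.
apply: (iffP exists_inP) => [[e eE /andP[xe ye]] | [e [eE xe ye]]].
  by exists e.
by exists e; rewrite ?xe.
Qed.

Lemma adjacent_sym x y : adjacent H x y = adjacent H y x.
Proof. by apply: eq_existsb => e; congr (_ && _); apply: andbC. Qed.

Lemma edge_vertex e v : e \in edges H -> v \in e -> v \in vertices H.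
Proof.
move=> eE; have /subsetP/(_ e eE) := edges_sub H; rewrite inE.
by move/subsetP; apply.
Qed.

Lemma linear_eq e f x y : e \in edges H -> f \in edges H -> x != y ->
  x \in e -> y \in e -> x \in f -> y \in f -> e = f.
Proof.
move=> eE fE xy xe ye xf yf; apply/eqP; apply: contraT => ef.
have := lin eE fE ef; rewrite leqNgt; case/negP.
apply: (@uniq_leq_card _ _ [:: x; y]); first by rewrite /= inE xy.
by rewrite /= !inE xe ye xf yf.
Qed.

Lemma edge_no4 e a b c v : e \in edges H -> uniq [:: a; b; c; v] ->
  a \in e -> b \in e -> c \in e -> v \in e -> False.
Proof.
move=> eE U ae be ce ve.
have := uniq_leq_card U (A := e).
by rewrite /= ae be ce ve (unif eE) => /(_ isT).
Qed.

Lemma edge_third e x y : e \in edges H -> x \in e -> y \in e -> x != y ->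
  exists z, [/\ z \in e, z != x, z != y &
    forall w, w \in e -> [|| w == x, w == y | w == z]].
Proof.
move=> eE xe ye xy.
have /set0Pn[z] : e :\: [set x; y] != set0.
  rewrite -card_gt0 cardsD (unif eE) subn_gt0.
  apply: leq_ltn_trans (subset_leq_card (subsetIr _ _)) _.
  by rewrite cards2 xy.
rewrite !inE negb_or => /andP[/andP[zx zy] ze]; exists z; split=> // w we.
apply: contraT; rewrite !negb_or => /and3P[wx wy wz].
case: (@edge_no4 e x y z w) => //.
by rewrite uniq4E xy eq_sym zx eq_sym wx eq_sym zy eq_sym wy eq_sym wz.
Qed.

Lemma edge_others e x : e \in edges H -> x \in e ->
  exists y z, [/\ y \in e, z \in e & uniq [:: x; y; z]].
Proof.
move=> eE xe; have /set0Pn[y] : e :\ x != set0.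
  by have := cardsD1 x e; rewrite xe (unif eE) -card_gt0; case: #|_|.
rewrite !inE eq_sym => /andP[xy ye].
have [z [ze zx zy _]] := edge_third eE xe ye xy.
by exists y, z; split=> //; rewrite uniq3E xy eq_sym zx eq_sym zy.
Qed.

Lemma uniq_degree v (s : seq {set T}) :
  uniq s -> all (fun e => (e \in edges H) && (v \in e)) s -> size s <= degree H v.
Proof. by move=> Us /allP sA; apply: uniq_leq_card => //; apply/allP=> e /sA; rewrite inE. Qed.

Lemma degree1_eq x e f : degree H x = 1 -> e \in edges H -> f \in edges H ->
  x \in e -> x \in f -> e = f.
Proof.
move=> dx eE fE xe xf; apply/eqP; apply: contraT => ef.
have := @uniq_degree x [:: e; f].
by rewrite dx /= inE ef eE fE xe xf => /(_ isT isT).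
Qed.

Lemma degree2_eq y e f g : degree H y <= 2 ->
  e \in edges H -> f \in edges H -> g \in edges H ->
  y \in e -> y \in f -> y \in g -> e != f -> g != e -> g = f.
Proof.
move=> dy eE fE gE ye yf yg ef ge; apply/eqP; apply: contraT => gf.
have := @uniq_degree y [:: e; f; g].
rewrite uniq3E ef ![_ == g]eq_sym ge gf /= eE fE gE ye yf yg => /(_ isT isT).
by rewrite leqNgt ltnS dy.
Qed.

Lemma sum_degree : \sum_(v in vertices H) degree H v = 3 * #|edges H|.
Proof.
transitivity (\sum_(v in vertices H) \sum_(e in edges H | v \in e) 1).
  apply: eq_bigr => v _; rewrite /degree -sum1_card.
  by apply: eq_bigl => e; rewrite inE.
rewrite (exchange_big_dep [in edges H]) /=; last by move=> v e _ /andP[].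
rewrite -sum1_card big_distrr /=; apply: eq_bigr => e eE.
rewrite muln1 -(unif eE) -sum1_card; apply: eq_bigl => v.
by case: (boolP (v \in e)) => [ve|_]; rewrite ?andbF // eE (edge_vertex eE ve).
Qed.

Lemma min_degreeP : vertices H != set0 ->
  (exists2 v, v \in vertices H & degree H v = min_degree H) /\
  {in vertices H, forall v, min_degree H <= degree H v}.
Proof.
move=> /set0Pn[v0 v0V].
have lb : {in vertices H, forall v, min_degree H <= degree H v}.
  move=> v vV; rewrite /min_degree.
  have: v \in index_enum T by rewrite mem_index_enum.
  elim: (index_enum T) => // w s IH; rewrite inE big_cons.
  case/orP=> [/eqP <- | /IH le]; first by rewrite vV geq_minl.
  by case: ifP => // _; apply: leq_trans (geq_minr _ _) le.
split=> //.
(* The iterated minimum is attained or equals its default [#|edges H|]; no degree exceeds the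
   default, so in the latter case any vertex attains it. *)
have : min_degree H = #|edges H| \/
    exists2 v, v \in vertices H & degree H v = min_degree H.
  rewrite /min_degree; elim/big_rec: _ => [|v m vV IH]; first by left.
  case: (leqP (degree H v) m) => [le|lt]; last by case: IH; auto.
  by right; exists v.
case=> // eq; exists v0 => //; apply/eqP; rewrite eqn_leq lb // andbT eq.
by apply: subset_leq_card; apply/subsetP => e; rewrite inE => /andP[].
Qed.

(** * C4-freeness and the size of cliques *)

Hypothesis noC4 : ~ has_berge_cycle 4 H.

Lemma no_berge4 a b c v e f g h :
  uniq [:: a; b; c; v] -> uniq [:: e; f; g; h] ->
  e \in edges H -> f \in edges H -> g \in edges H -> h \in edges H ->
  a \in e -> b \in e -> b \in f -> c \in f -> c \in g -> v \in g ->
  v \in h -> a \in h -> False.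
Proof.
move=> Uv Ue eE fE gE hE ae be bf cf cg vg vh ah; apply: noC4.
exists (fun i : 'I_4 => nth a [:: a; b; c; v] i).
exists (fun i : 'I_4 => nth e [:: e; f; g; h] i).
split.
- by move=> i j /eqP; rewrite nth_uniq // => /eqP/val_inj.
- by move=> i j /eqP; rewrite nth_uniq // => /eqP/val_inj.
- by case=> [[|[|[|[|]]]]].
Qed.


Lemma linear_notin e f x y : e \in edges H -> f \in edges H -> e != f ->
  x != y -> x \in e -> x \in f -> y \in f -> y \notin e.
Proof.
move=> eE fE ef xy xe xf yf; apply: contra ef => ye.
by apply/eqP; apply: (@linear_eq _ _ x y).
Qed.

Lemma mem_neq e f x : x \in e -> x \notin f -> e != f.
Proof. by move=> xe; apply: contraNneq => <-. Qed.

Lemma edge_cover e x y z w : e \in edges H -> uniq [:: x; y; z] ->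
  x \in e -> y \in e -> z \in e -> w \in e -> [|| w == x, w == y | w == z].
Proof.
move=> eE; rewrite uniq3E => /and3P[xy xz yz] xe ye ze we; apply: contraT.
rewrite !negb_or => /and3P[wx wy wz]; case: (@edge_no4 e x y z w) => //.
by rewrite uniq4E xy xz yz ![_ == w]eq_sym wx wy wz.
Qed.

(** Distinct connecting edges [m] and [k] would close the cycle [z], [f1], [u1], [m], [u2], [k],
    [u3], [f3]. The edge [f2] keeps [u2] off [f1] and [f3], which tells [m] and [k] from these
    two. *)
Lemma triangle_edge z u1 u2 u3 f1 f2 f3 :
  f1 \in edges H -> f2 \in edges H -> f3 \in edges H ->
  uniq [:: f1; f2; f3] -> uniq [:: z; u1; u2; u3] ->
  z \in f1 -> z \in f2 -> z \in f3 -> u1 \in f1 -> u2 \in f2 -> u3 \in f3 ->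
  adjacent H u1 u2 -> adjacent H u2 u3 ->
  exists2 m, m \in edges H & [/\ u1 \in m, u2 \in m & u3 \in m].
Proof.
move=> f1E f2E f3E Uf Uz zf1 zf2 zf3 u1f u2f u3f.
move=> /adjacentP[m [mE u1m u2m]] /adjacentP[k [kE u2k u3k]].
have [mk | mk] := eqVneq m k; first by exists m => //; rewrite {3}mk.
have /and3P[f12 f13 f23] : [&& f1 != f2, f1 != f3 & f2 != f3] by rewrite -uniq3E.
have zu2 : z != u2 by move: Uz; rewrite uniq4E; case/andP=> _ /andP[].
have u2f1 : u2 \notin f1 by apply: (linear_notin f1E f2E f12 zu2).
have u2f3 : u2 \notin f3.
  by apply: (linear_notin f3E f2E _ zu2) => //; rewrite eq_sym.
case: (@no_berge4 z u1 u2 u3 f1 m k f3) => //.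
rewrite uniq4E mk f13 (mem_neq u2m u2f3) (mem_neq u2k u2f3).
by rewrite ![f1 == _]eq_sym (mem_neq u2m u2f1) (mem_neq u2k u2f1).
Qed.

(** Among six such vertices, three on distinct edges through a fourth vertex [z] fill an edge [m] by
    [triangle_edge]. A further vertex [u4] shares with [z] an edge missing two of the three, so the
    same lemma puts [u4] into [m] as a fourth vertex. *)
Lemma card_clique_le5 (S : {set T}) :
  {in S &, forall x y, x != y -> adjacent H x y} -> #|S| <= 5.
Proof.
move=> clS; rewrite leqNgt; apply/negP => S6.
have pick (A : {set T}) : #|A| < #|S| -> exists2 u, u \in S & u \notin A.
  move=> ltAS; have /subsetPn[u uS uA] : ~~ (S \subset A).
    by apply: contraL ltAS => /subset_leq_card; rewrite leqNgt.
  by exists u.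
have [z zS _] : exists2 u, u \in S & u \notin set0.
  by apply: pick; rewrite cards0; apply: leq_trans S6.
have star u (A : {set T}) : u \in S -> u \notin A -> z \in A ->
    z != u /\ exists f, [/\ f \in edges H, z \in f & u \in f].
  move=> uS uA zA; have zu : z != u by apply: contraNneq uA => <-.
  by split=> //; apply/adjacentP/clS.
have [u1 u1S u1A] : exists2 u, u \in S & u \notin [set z].
  by apply: pick; rewrite cards1; apply: leq_trans S6.
have [zu1 [f1 [f1E zf1 u1f1]]] := star _ _ u1S u1A (set11 z).
have [u2 u2S u2f1] : exists2 u, u \in S & u \notin f1.
  by apply: pick; rewrite (unif f1E); apply: leq_trans S6.
have [zu2 [f2 [f2E zf2 u2f2]]] := star _ _ u2S u2f1 zf1.
(* The set to avoid has at most 3 + 2 vertices; this is where six vertices are needed. *)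
have [u3 u3S u3f] : exists2 u, u \in S & u \notin f1 :|: f2 :\ z.
  apply: pick; apply: leq_ltn_trans (leq_card_setU _ _).1 _.
  by have := cardsD1 z f2; rewrite zf2 (unif f1E) (unif f2E); case: #|_| => [|[|[|[]]]].
have [|zu3 [f3 [f3E zf3 u3f3]]] := star _ _ u3S u3f; first by rewrite inE zf1.
move: u3f; rewrite !inE negb_or negb_and negbK eq_sym (negPf zu3) /=.
move=> /andP[u3f1 u3f2].
have f21 := mem_neq u2f2 u2f1; have f31 := mem_neq u3f3 u3f1.
have f32 := mem_neq u3f3 u3f2.
have u12 : u1 != u2 by apply: contraNneq u2f1 => <-.
have u13 : u1 != u3 by apply: contraNneq u3f1 => <-.
have u23 : u2 != u3 by apply: contraNneq u3f2 => <-.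
have [||m mE [u1m u2m u3m]] :=
    @triangle_edge z u1 u2 u3 f1 f2 f3 f1E f2E f3E _ _ zf1 zf2 zf3 u1f1 u2f2 u3f3
      (clS _ _ u1S u2S u12) (clS _ _ u2S u3S u23).
- by rewrite uniq3E ![f1 == _]eq_sym f21 f31 eq_sym f32.
- by rewrite uniq4E zu1 zu2 zu3 u12 u13 u23.
have [u4 u4S u4A] : exists2 u, u \in S & u \notin z |: [set u1; u2; u3].
  apply: pick; apply: leq_ltn_trans (leq_card_setU _ _).1 _.
  apply: leq_ltn_trans (leq_add (leqnn _) (leq_card_setU _ _).1) _.
  by rewrite !cards1 cards2 u12; apply: leq_trans S6.
have [|zu4 [f4 [f4E zf4 u4f4]]] := star _ _ u4S u4A; first by rewrite setU11.
move: u4A; rewrite !inE !negb_or -!andbA => /and4P[_ u41 u42 u43].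
have off u v f g : u \in S -> v \in S -> u \in m -> v \in m -> u != v ->
    z != u -> z != v -> u4 != u -> u4 != v ->
    f \in edges H -> g \in edges H -> f != g -> z \in f -> z \in g ->
    u \in f -> v \in g -> u \notin f4 -> v \notin f4 -> False.
  move=> uS vS um vm uv zu zv u4u u4v fE gE fg zf zg uf vg uf4 vf4.
  have [||m' m'E [u4m' um' vm']] :=
    @triangle_edge z u4 u v f4 f g f4E fE gE _ _ zf4 zf zg u4f4 uf vg
      (clS _ _ u4S uS u4u) (clS _ _ uS vS uv).
  - by rewrite uniq3E fg ![f4 == _]eq_sym (mem_neq uf uf4) (mem_neq vg vf4).
  - by rewrite uniq4E zu4 zu zv u4u u4v uv.
  case: (@edge_no4 m u1 u2 u3 u4) => //.
    by rewrite uniq4E u12 u13 u23 ![_ == u4]eq_sym u41 u42 u43.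
  by rewrite (@linear_eq m m' u v).
(* [f4] contains [z] and [u4], so it has room for only one of [u1], [u2], [u3], and [off] applies to
   two others. *)
have one u v : u \in f4 -> z != u -> z != v -> u4 != u -> u4 != v ->
    u != v -> v \notin f4.
  move=> uf4 zu zv u4u u4v uv; apply/negP=> vf4.
  by apply: (@edge_no4 f4 z u4 u v) => //; rewrite uniq4E zu4 zu zv u4u u4v uv.
have [u1f4|u1f4] := boolP (u1 \in f4).
  by apply: (off u2 u3 f2 f3); rewrite ?(one u1) // eq_sym.
have [u2f4|u2f4] := boolP (u2 \in f4).
  by apply: (off u1 u3 f1 f3); rewrite ?(one u2) // eq_sym.
by apply: (off u1 u2 f1 f2) => //; rewrite eq_sym.
Qed.

(** * Leaf edges when any two vertices are adjacent or linked *)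

Hypothesis tight : {in vertices H &, forall x y, x != y ->
  adjacent H x y \/ linked3 H x y}.

(** A vertex off the only edge of [x] is not adjacent to [x], so a Berge path leads to it, and this
    path can only start with [e]. *)
Lemma leaf_path x e v : degree H x = 1 -> e \in edges H -> x \in e ->
  v \in vertices H -> v \notin e -> exists a b f g,
  [/\ uniq [:: x; a; b; v], uniq [:: e; f; g], f \in edges H /\ g \in edges H,
      [/\ a \in e, a \in f & b \in f] & b \in g /\ v \in g].
Proof.
move=> dx eE xe vV ve.
have xv : x != v by apply: contraNneq ve => <-.
case: (tight (edge_vertex eE xe) vV xv) => [/adjacentP[h [hE xh vh]]|].
  by rewrite (degree1_eq dx eE hE xe xh) vh in ve.
move=> [a [b [e' [f [g [Uv Ue [e'E fE gE] [xe' ae' af bf] [bg vg]]]]]]].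
exists a, b, f, g; rewrite (degree1_eq dx eE e'E xe xe'); split=> //.
Qed.

(** The path between the two leaves starts with [e] and ends with [f], and [m] is its middle edge.
    If a common vertex [w] were [a], then [m] would share two vertices with [f]; if it were [b], two
    with [e]. *)
Lemma leaf_link x e x' f : degree H x = 1 -> degree H x' = 1 ->
  e \in edges H -> f \in edges H -> x \in e -> x' \in f -> e != f ->
  exists a b m,
  [/\ [/\ m \in edges H, m != e & m != f],
      [/\ a != b, a != x & b != x'],
      [/\ a \in e, b \in f, a \in m & b \in m] &
      forall w, w \in e -> w \in f -> a != w /\ b != w].
Proof.
move=> dx dx' eE fE xe x'f ef.
have x'e : x' \notin e by apply: contraNN ef => x'e; rewrite (degree1_eq dx' eE fE x'e x'f).
have [a [b [m [g [Uv Ue [mE gE] [ae am bm] [bg x'g]]]]]] :=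
  leaf_path dx eE xe (edge_vertex fE x'f) x'e.
move: Uv Ue; rewrite uniq4E uniq3E => /and5P[xa _ _ ab /andP[_ bx']].
rewrite -(degree1_eq dx' fE gE x'f x'g) in bg *.
move=> /and3P[em _ mf]; exists a, b, m; split=> //.
- by split=> //; rewrite eq_sym.
- by split=> //; rewrite eq_sym.
move=> w we wf; split.
  apply: contraNneq mf => aw; apply/eqP; apply: (@linear_eq m f a b) => //.
  by rewrite aw.
apply: contraNneq em => bw; apply/eqP; apply: (@linear_eq e m a b) => //.
by rewrite bw.
Qed.

(** A path from [x] to a vertex of [m] leaves [e] at [z]: if it left at [y], its second edge would
    be [m], and so would its last one. If its last edge were not [m], there would be a C4. So it
    enters [m] at a vertex adjacent to [z]. *)
Lemma low_adjacent x y z e m p : degree H x = 1 -> degree H y <= 2 ->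
  uniq [:: x; y; z] -> e \in edges H -> x \in e -> y \in e -> z \in e ->
  m \in edges H -> m != e -> y \in m -> p \in m -> p != y -> adjacent H z p.
Proof.
move=> dx dy U eE xe ye ze mE me ym pm py.
have other p' : p' \in m -> p' != y ->
    exists q, [/\ q \in m, q != y, q != p' & adjacent H z q].
  move=> {p pm py} pm py; rename p' into p.
  have /and3P[xy xz yz] : [&& x != y, x != z & y != z] by rewrite -uniq3E.
  have em : e != m by rewrite eq_sym.
  have pe : p \notin e by apply: (linear_notin eE mE em _ ye ym pm); rewrite eq_sym.
  have zm : z \notin m by apply: (linear_notin mE eE me yz ym ye ze).
  have [a [b [f [g [Uv Ue [fE gE] [ae af bf] [bg pg]]]]]] :=
    leaf_path dx eE xe (edge_vertex mE pm) pe.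
  move: Uv Ue; rewrite uniq4E uniq3E => /and5P[xa xb xp ab /andP[ap bp]].
  move=> /and3P[ef eg fg].
  case/or3P: (edge_cover eE U xe ye ze ae) => /eqP aE.
  - by rewrite aE eqxx in xa.
  - rewrite aE in ab af.
    have fm : f = m by apply: (degree2_eq dy eE mE fE) => //; rewrite eq_sym.
    case/eqP: fg; rewrite fm in bf *.
    exact: (@linear_eq m g b p).
  - rewrite {a ae xa}aE in ab af ap.
    have yb : y != b.
      apply: contraNneq ef => yb; apply/eqP; apply: (@linear_eq e f y z) => //.
      by rewrite yb.
    have [gm|gm] := eqVneq g m.
      exists b; split=> //; first by rewrite -gm.
        by rewrite eq_sym.
      by apply/adjacentP; exists f.
    case: (@no_berge4 y p b z m g f e) => //.
      by rewrite uniq4E eq_sym py yb yz eq_sym bp ![_ == z]eq_sym ap ab.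
    by rewrite uniq4E eq_sym gm me [g == f]eq_sym fg [g == e]eq_sym eg
      [f == e]eq_sym ef eq_sym (mem_neq af zm).
(* The path to [p] only shows that the third vertex [q] of [m] is adjacent to [z]; the path to [q]
   then gives the same for [p]. *)
have [q [qm qy qp zq]] := other _ pm py.
have [p' [p'm p'y p'q zp']] := other _ qm qy.
have Uq : uniq [:: y; p; q] by rewrite uniq3E ![y == _]eq_sym py qy eq_sym qp.
case/or3P: (edge_cover mE Uq ym pm qm p'm) => /eqP eqp'.
- by rewrite eqp' eqxx in p'y.
- by rewrite -eqp'.
- by rewrite eqp' eqxx in p'q.
Qed.

(** If [y] has a second edge, [low_adjacent] joins [z] to its two other vertices by two new edges.
    If not, every path from [x] leaves [e] at [z], and two such paths, the second ending where the
    first one was after its second edge, use distinct edges at [z]. *)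
Lemma low_degree x y z e : degree H x = 1 -> degree H y <= 2 ->
  uniq [:: x; y; z] -> e \in edges H -> x \in e -> y \in e -> z \in e ->
  3 < #|vertices H| -> 2 < degree H z.
Proof.
move=> dx dy U eE xe ye ze V4.
have /and3P[xy xz yz] : [&& x != y, x != z & y != z] by rewrite -uniq3E.
have [/existsP[m /and3P[mE ym me]]|noy] :=
    boolP [exists m, [&& m \in edges H, y \in m & m != e]].
  have [p [q [pm qm Um]]] := edge_others mE ym.
  have /and3P[yp yq pq] : [&& y != p, y != q & p != q] by rewrite -uniq3E.
  have zm : z \notin m by apply: (linear_notin mE eE me yz).
  have pe : p \notin e by apply: (linear_notin eE mE _ yp) => //; rewrite eq_sym.
  have qe : q \notin e by apply: (linear_notin eE mE _ yq) => //; rewrite eq_sym.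
  have /adjacentP[g [gE zg pg]] : adjacent H z p.
    by apply: (low_adjacent dx dy U eE xe ye ze mE me ym pm); rewrite eq_sym.
  have /adjacentP[h [hE zh qh]] : adjacent H z q.
    by apply: (low_adjacent dx dy U eE xe ye ze mE me ym qm); rewrite eq_sym.
  apply: (@uniq_degree z [:: e; g; h]); last by rewrite /= eE gE hE ze zg zh.
  rewrite uniq3E ![e == _]eq_sym (mem_neq pg pe) (mem_neq qh qe) /=.
  apply: contraNneq zm => gh.
  by rewrite -(@linear_eq h m p q) // -gh.
have away v : v \in vertices H -> v \notin e -> exists b f g,
    [/\ v != b /\ z != b, [/\ f \in edges H, f != e, z \in f & b \in f] &
        [/\ g \in edges H, g != f, b \in g & v \in g]].
  move=> vV ve.
  have [a [b [f [g [Uv Ue [fE gE] [ae af bf] [bg vg]]]]]] := leaf_path dx eE xe vV ve.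
  move: Uv Ue; rewrite uniq4E uniq3E => /and5P[xa xb xv ab /andP[av bv]].
  move=> /and3P[ef eg fg].
  case/or3P: (edge_cover eE U xe ye ze ae) => /eqP aE.
  - by rewrite aE eqxx in xa.
  - case/existsP: noy; exists f; rewrite fE -aE af eq_sym ef //.
  - exists b, f, g; split=> //; first by rewrite eq_sym bv -aE.
      by split; rewrite // -?aE // eq_sym.
    by split; rewrite // eq_sym.
have [v vV ve] : exists2 v, v \in vertices H & v \notin e.
  apply/subsetPn; apply: contraL V4 => /subset_leq_card.
  by rewrite (unif eE) leqNgt.
have [b [f [_ [[_ zb] [fE fe zf bf] _]]]] := away v vV ve.
have be : b \notin e by apply: (linear_notin eE fE _ zb) => //; rewrite eq_sym.
have [b' [f' [g [[bb' _] [f'E f'e zf' b'f'] [gE gf' b'g bg]]]]] :=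
  away b (edge_vertex fE bf) be.
apply: (@uniq_degree z [:: e; f; f']); last by rewrite /= eE fE f'E ze zf zf'.
rewrite uniq3E ![e == _]eq_sym fe f'e /=.
apply: contraNneq gf' => ff'; apply/eqP; apply: (@linear_eq g f' b b') => //.
by rewrite -ff'.
Qed.

(** * Vertices that leaf edges may overdraw: core and full *)

Hypothesis V4 : 3 < #|vertices H|.

(* [z] is the vertex that pays for the whole of a leaf edge, because the edge
   has no other vertex of degree at least 3. *)
Definition core z := (2 < degree H z) && [exists x, exists y, exists e in edges H,
  [&& degree H x == 1, degree H y <= 2, uniq [:: x; y; z], x \in e, y \in e & z \in e]].

Lemma coreP z : reflect (2 < degree H z /\ exists x y e,
    [/\ degree H x = 1, degree H y <= 2, uniq [:: x; y; z], e \in edges H &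
        [/\ x \in e, y \in e & z \in e]]) (core z).
Proof.
apply: (iffP andP) => [[dz /existsP[x /existsP[y /exists_inP[e eE]]]] | ].
  case/and5P=> /eqP dx dy U xe /andP[ye ze]; split=> //.
  by exists x, y, e.
move=> [dz [x [y [e [dx dy U eE [xe ye ze]]]]]]; split=> //.
apply/existsP; exists x; apply/existsP; exists y; apply/exists_inP; exists e => //.
by rewrite dx dy U xe ye ze.
Qed.

(** The leaf edges of [z] and [w] are linked by a third edge. Where it ends in the vertex of degree
    at most 2 instead of the core, [low_adjacent] moves that end to the core. *)
Lemma core_adjacent z w : core z -> core w -> z != w -> adjacent H z w.
Proof.
move=> /coreP[dz [x [y [e [dx dy U eE [xe ye ze]]]]]].
move=> /coreP[dw [x' [y' [f [dx' dy' U' fE [x'f y'f wf]]]]]] zw.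
have zf : z \notin f.
  apply/negP=> zf; case/or3P: (edge_cover fE U' x'f y'f wf zf) => /eqP zE.
  - by rewrite zE dx' in dz.
  - by rewrite zE ltnNge dy' in dz.
  - by rewrite zE eqxx in zw.
have [a [b [m [[mE me mf] [ab ax bx'] [ae bf am bm] _]]]] :=
  leaf_link dx dx' eE fE xe x'f (mem_neq ze zf).
have zb : adjacent H z b.
  case/or3P: (edge_cover eE U xe ye ze ae) => /eqP aE.
  - by rewrite aE eqxx in ax.
  - apply: (low_adjacent dx dy U eE xe ye ze mE me _ bm); last by rewrite eq_sym -aE.
    by rewrite -aE.
  - by apply/adjacentP; exists m; rewrite -aE.
case/or3P: (edge_cover fE U' x'f y'f wf bf) => /eqP bE.
- by rewrite bE eqxx in bx'.
- rewrite bE in zb; case/adjacentP: zb => k [kE zk y'k].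
  rewrite adjacent_sym.
  apply: (low_adjacent dx' dy' U' fE x'f y'f wf kE (mem_neq zk zf) y'k zk).
  by apply: contraTneq dz => ->; rewrite -leqNgt.
- by rewrite -bE.
Qed.

(** Each edge at such a vertex claims a share. With degree 3, three half units exceed the surplus of
    one unit. *)
Definition full v :=
  (2 < degree H v) && [forall e in edges H, (v \in e) ==> [exists x in e, degree H x == 1]].

Lemma full_leaf v e : full v -> e \in edges H -> v \in e ->
  exists x, [/\ x \in e, degree H x = 1 & x != v].
Proof.
case/andP=> dv /forall_inP/(_ e) fv eE ve.
move/implyP: (fv eE) => /(_ ve)/exists_inP[x xe /eqP dx].
by exists x; split=> //; apply: contraTneq dv => <-; rewrite dx.
Qed.

(* The edges at a full vertex are leaf edges, so two of their outer vertices
   are linked only by an edge avoiding [v], and C4-freeness merges these. *)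
Lemma full_neighbor v e r f x : full v -> e \in edges H -> v \in e -> r \in e ->
  r != v -> f \in edges H -> r \in f -> x \in f -> degree H x = 1 -> f = e.
Proof.
move=> fv eE ve re rv fE rf xf dx; apply/eqP; apply: contraT => fe.
have ef : e != f by rewrite eq_sym.
have dv : 2 < degree H v by case/andP: fv.
have vf : v \notin f by apply: (linear_notin fE eE fe rv).
have [p [pe dp pv]] := full_leaf fv eE ve.
have pr : p != r.
  by apply: contraNneq fe => pr; rewrite (degree1_eq dp fE eE) ?pr.
have Ue : uniq [:: v; p; r] by rewrite uniq3E ![v == _]eq_sym pv rv pr.
have cov a : a \in e -> a != p -> (a == v) || (a == r).
  move=> ae ap; have := edge_cover eE Ue ve pe re ae.
  by rewrite (negPf ap).
have [a [r' [m [[mE me mf] [ar' ap r'x] [ae r'f am r'm] common]]]] :=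
  leaf_link dp dx eE fE pe xf ef.
have [ar r'r] := common r re rf.
have aE : a = v by case/orP: (cov a ae ap) => /eqP // aE; rewrite aE eqxx in ar.
rewrite {a ae ap ar common}aE in ar' am.
have [g [gE vg ge gm]] : exists g, [/\ g \in edges H, v \in g, g != e & g != m].
  have /subsetPn[g] : ~~ ([set e in edges H | v \in e] \subset [set e; m]).
    apply: contraL dv => /subset_leq_card; rewrite /degree cards2 -leqNgt.
    by move/leq_trans; apply; case: (_ != _).
  by rewrite !inE negb_or => /andP[gE vg] /andP[ge gm]; exists g.
have eg : e != g by rewrite eq_sym.
have [q [qg dq qv]] := full_leaf fv gE vg.
have [c [t [k [[kE ke kg] [ct cp tq] [ce tg ck tk] common']]]] :=
  leaf_link dp dq eE gE pe qg eg.
have [cv tv] := common' v ve vg.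
have cE : c = r by case/orP: (cov c ce cp) => /eqP // cE; rewrite cE eqxx in cv.
rewrite {c ce cp cv common'}cE in ct ck.
have tm : t \notin m by apply: (linear_notin mE gE _ _ am vg tg); rewrite eq_sym.
have rm : r \notin m by apply: (linear_notin mE eE me _ am ve re); rewrite eq_sym.
have fk : f != k.
  apply/eqP=> fk; have r't : r' != t by apply: contraNneq tm => <-.
  have tf : t \in f by rewrite fk.
  case: (@edge_no4 f r r' t x) => //; rewrite uniq4E ct [r == r']eq_sym r'r r't r'x.
  rewrite (contraNneq _ fe) => [|rx]; last by rewrite (degree1_eq dx fE eE) // -rx.
  rewrite (contraNneq _ vf) // => tx.
  by rewrite (degree1_eq dx fE gE) // -tx.
(* The four linking and linked edges form the cycle [v], [m], [r'], [f], [r], [k], [t], [g]. *)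
case: (@no_berge4 v r' r t m f k g) => //.
  rewrite uniq4E ar' ![v == _]eq_sym rv tv r'r ct /=.
  by rewrite andbT; apply: contraNneq tm => <-.
rewrite uniq4E mf fk kg [m == k]eq_sym (mem_neq ck rm) [m == g]eq_sym gm.
by rewrite [f == g]eq_sym (mem_neq vg vf).
Qed.

(** By [full_neighbor] the leaf edge making [z] a core is its common edge with [v]; the vertices of
    that edge other than [z] have degree at most 2. *)
Lemma core_full z v : core z -> core v -> full v -> z = v.
Proof.
move=> cz cv fv; apply/eqP; apply: contraT => zv.
have [e [eE ze ve]] := adjacentP _ _ (core_adjacent cz cv zv).
case/coreP: cz => dz [x [y [f [dx dy U fE [xf yf zf]]]]].
have fe := full_neighbor fv eE ve ze zv fE zf xf dx.
have dv : 2 < degree H v by case/andP: fv.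
have vf : v \in f by rewrite fe.
case/or3P: (edge_cover fE U xf yf zf vf) => /eqP vE.
- by rewrite vE dx in dv.
- by rewrite vE ltnNge dy in dv.
- by rewrite vE eqxx in zv.
Qed.

(** An edge linking [e] to another leaf edge at [v] would have to start at [x'], which lies on no
    edge but [e]. *)
Lemma double_leaf_edge v e f x x' y : degree H x = 1 -> degree H x' = 1 ->
  degree H y = 1 -> e \in edges H -> f \in edges H -> uniq [:: x; x'; v] ->
  x \in e -> x' \in e -> v \in e -> v \in f -> y \in f -> f = e.
Proof.
move=> dx dx' dy eE fE U xe x'e ve vf yf.
apply/eqP; apply: contraT; rewrite eq_sym => ef.
have [a [b [m [[mE me _] [_ ax _] [ae _ am _] common]]]] :=
  leaf_link dx dy eE fE xe yf ef.
have [av _] := common v ve vf.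
case/or3P: (edge_cover eE U xe x'e ve ae) => /eqP aE.
- by rewrite aE eqxx in ax.
- by rewrite (degree1_eq dx' mE eE) ?eqxx // -aE in me.
- by rewrite aE eqxx in av.
Qed.

(** * Discharging the deficit of the leaves *)

Definition leaves v := [set x in vertices H | (degree H x == 1) && adjacent H x v].

(** If some edge holds two leaves besides [v], it holds all leaves at [v], at most 2 of them.
    Otherwise sending a leaf to its edge is injective, and if [v] is not full, some edge at [v] is
    missed. *)
Lemma card_leaves v : 2 < degree H v -> #|leaves v| + ~~ full v <= degree H v.
Proof.
move=> dv.
have leafP x : x \in leaves v -> degree H x = 1 /\ x != v.
  rewrite inE => /and3P[_ /eqP dx _]; split=> //.
  by apply: contraTneq dv => <-; rewrite dx.
have [/existsP[x /existsP[x' /exists_inP[e eE]]]|single] := boolP [exists x, exists x',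
  exists e in edges H,
    [&& x \in leaves v, x' \in leaves v, x != x', v \in e, x \in e & x' \in e]].
  case/and5P=> xL x'L xx' ve /andP[xe x'e].
  have [dx xv] := leafP x xL; have [dx' x'v] := leafP x' x'L.
  have sub : leaves v \subset e :\ v.
    apply/subsetP=> y yL; have [dy yv] := leafP y yL.
    move: yL; rewrite inE => /and3P[_ _ /adjacentP[f [fE yf vf]]].
    rewrite !inE yv -(double_leaf_edge dx dx' dy eE fE _ xe x'e ve vf yf) //.
    by rewrite uniq3E xx' xv.
  apply: leq_trans dv; rewrite -addn1 leq_add ?leq_b1 //.
  apply: leq_trans (subset_leq_card sub) _.
  by have := cardsD1 v e; rewrite ve (unif eE); case: #|_| => [|[|[]]].
pose edge_of x := odflt set0 [pick e in edges H | (x \in e) && (v \in e)].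
have edge_ofP x : x \in leaves v ->
    [/\ edge_of x \in edges H, x \in edge_of x & v \in edge_of x].
  rewrite inE => /and3P[_ _ /adjacentP[e [eE xe ve]]].
  rewrite /edge_of; case: pickP => [f /and3P[] // | /(_ e)].
  by rewrite /= eE xe ve.
have inj : {in leaves v &, injective edge_of}.
  move=> x x' xL x'L eqx; apply/eqP; apply: contraNT single => xx'.
  have [eE xe ve] := edge_ofP x xL; have [_ x'e _] := edge_ofP x' x'L.
  apply/existsP; exists x; apply/existsP; exists x'; apply/exists_inP.
  by exists (edge_of x) => //; rewrite xL x'L xx' ve xe eqx x'e.
rewrite -(card_in_imset inj) /degree.
have sub : edge_of @: leaves v \subset [set e in edges H | v \in e].
  apply/subsetP=> _ /imsetP[x xL ->]; have [eE _ ve] := edge_ofP x xL.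
  by rewrite inE eE ve.
have [fv|] := boolP (full v); first by rewrite addn0 subset_leq_card.
rewrite /full dv negb_forall_in => /exists_inP[e eE].
rewrite negb_imply => /andP[ve nox]; rewrite addn1 proper_card //.
rewrite properE sub; apply/subsetPn; exists e; first by rewrite inE eE ve.
apply: contraNN nox => /imsetP[x xL ->]; apply/exists_inP; exists x.
  by have [] := edge_ofP x xL.
by have [-> _] := leafP x xL.
Qed.

Definition third_vertex (P : pred T) x v := [exists y, exists e in edges H,
  [&& P y, uniq [:: x; y; v], x \in e, y \in e & v \in e]].

Lemma third_vertexP (P : pred T) x v : reflect (exists y e,
  [/\ P y, uniq [:: x; y; v], e \in edges H & [/\ x \in e, y \in e & v \in e]])
  (third_vertex P x v).
Proof.
apply: (iffP existsP) => [[y /exists_inP[e eE /and5P[Py U xe ye ve]]] |].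
  by exists y, e.
move=> [y [e [Py U eE [xe ye ve]]]]; exists y; apply/exists_inP; exists e => //.
by rewrite Py U xe ye ve.
Qed.

(* Twice the share of the leaf [x] paid by [v]: the two other vertices of a
   leaf edge pay half each, except that vertices of degree 2, and full vertices
   with a partner of degree at least 3, pass their share to the partner. *)
Definition charge x v : nat :=
  if ~~ ((2 < degree H v) && adjacent H x v) then 0
  else if third_vertex (fun y => degree H y <= 2) x v then 2
  else if full v then 0
  else if third_vertex full x v then 2 else 1.

Lemma charge_le2 x v : charge x v <= 2.
Proof. by rewrite /charge; do !case: ifP => _. Qed.

(** Let [y] and [z] be the other vertices of the leaf edge. If one has degree at most 2, the other
    has larger degree by [low_degree] and pays 2; if one is full, the other is not and pays 2;
    otherwise each pays 1. *)
Lemma sum_charge x : x \in vertices H -> degree H x = 1 ->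
  2 <= \sum_(v in vertices H) charge x v.
Proof.
move=> xV dx.
have /set0Pn[e] : [set e in edges H | x \in e] != set0.
  by rewrite -card_gt0 -/(degree H x) dx.
rewrite inE => /andP[eE xe].
have [y [z [ye ze U]]] := edge_others eE xe.
have /and3P[xy xz yz] : [&& x != y, x != z & y != z] by rewrite -uniq3E.
have U' : uniq [:: x; z; y] by rewrite uniq3E xz xy eq_sym yz.
have yV := edge_vertex eE ye; have zV := edge_vertex eE ze.
have ax w : w \in e -> adjacent H x w by move=> we; apply/adjacentP; exists e.
rewrite (bigD1 y) //= (bigD1 z) /=; last by rewrite zV eq_sym.
rewrite addnA; apply: leq_trans (leq_addr _ _).
have [ly|hy] := leqP (degree H y) 2.
  have hz := low_degree dx ly U eE xe ye ze V4.
  have low : third_vertex (fun w => degree H w <= 2) x z by apply/third_vertexP; exists y, e.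
  by rewrite [X in _ + X]/charge hz (ax z ze) low leq_addl.
have [lz|hz] := leqP (degree H z) 2.
  have low : third_vertex (fun w => degree H w <= 2) x y by apply/third_vertexP; exists z, e.
  by rewrite {1}/charge hy (ax y ye) low leq_addr.
have lowF a b : uniq [:: x; a; b] -> a \in e -> b \in e -> 2 < degree H a ->
    third_vertex (fun c => degree H c <= 2) x b = false.
  move=> Ua ae be ha; apply/third_vertexP => -[c [f [lc Uc fE [xf cf bf]]]].
  rewrite (degree1_eq dx fE eE xf xe) in cf bf.
  move: Uc; rewrite uniq3E => /and3P[xc _ cb].
  case/or3P: (edge_cover eE Ua xe ae be cf) => /eqP cE.
  - by rewrite cE eqxx in xc.
  - by rewrite ltnNge -cE lc in ha.
  - by rewrite cE eqxx in cb.
(* A second edge at [y] would hold a leaf, contrary to [full_neighbor] at [z]. *)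
have notboth : ~~ (full y && full z).
  apply/negP=> /andP[fy fz].
  have [g [gE yg ge]] : exists g, [/\ g \in edges H, y \in g & g != e].
    have /subsetPn[g] : ~~ ([set e in edges H | y \in e] \subset [set e]).
      apply: contraL hy => /subset_leq_card; rewrite /degree cards1 -leqNgt.
      by move/leq_trans; apply.
    by rewrite !inE => /andP[gE yg] ge; exists g.
  have [p [pg dp py]] := full_leaf fy gE yg.
  by rewrite (full_neighbor fz eE ze ye yz gE yg pg dp) eqxx in ge.
have fullT a b : uniq [:: x; a; b] -> a \in e -> b \in e -> full a ->
    third_vertex full x b.
  by move=> Ua ae be fa; apply/third_vertexP; exists a, e.
rewrite /charge hy hz (ax y ye) (ax z ze) (lowF z y) // (lowF y z) //=.
have [fy|nfy] := boolP (full y).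
  by move: notboth; rewrite fy /= => /negPf->; rewrite (fullT y z).
have [fz|nfz] := boolP (full z); first by rewrite (fullT z y).
by do !case: ifP.
Qed.

Hypothesis deg_gt0 : {in vertices H, forall v, 0 < degree H v}.

(** The balance at [v] in half units: the payments stay within the surplus over degree 2, apart from
    an overdraft of one unit for a core and another one if it is also full. The last term refunds
    the deficit of a leaf. *)
Lemma charge_bound v : v \in vertices H ->
  4 + \sum_(x in vertices H | degree H x == 1) charge x v <=
  2 * degree H v + 2 * core v + 2 * (core v && full v) + 2 * (degree H v == 1).
Proof.
move=> vV; have [lv|hv] := leqP (degree H v) 2.
  rewrite big1 => [|x _]; last by rewrite /charge ltnNge lv.
  by move: lv (deg_gt0 vV); case: (degree H v) => [|[|[|]]] //=; lia.
have -> : \sum_(x in vertices H | degree H x == 1) charge x v =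
    \sum_(x in leaves v) charge x v.
  rewrite (bigID (fun x => adjacent H x v)) /= addnC big1 => [|x /andP[_ /negPf nxv]].
    by apply: eq_bigl => x; rewrite inE andbA.
  by rewrite /charge nxv andbF.
have cardL := card_leaves hv.
have [cv|ncv] := boolP (core v).
  have le : \sum_(x in leaves v) charge x v <= #|leaves v| * 2.
    by rewrite -sum_nat_const; apply: leq_sum => x _; apply: charge_le2.
  by case: (full v) cardL => /=; lia.
have lowF x : x \in leaves v -> third_vertex (fun c => degree H c <= 2) x v = false.
  rewrite inE => /and3P[_ /eqP dx _]; apply: contraNF ncv => /third_vertexP.
  by move=> [y [e [ly U eE mem]]]; apply/coreP; split=> //; exists x, y, e.
have [fv|nfv] := boolP (full v).
  rewrite big1 => [|x xL]; first by lia.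
  by rewrite /charge lowF // fv; case: ifP.
rewrite nfv /= in cardL.
(* A vertex paying in place of a full partner [y] has a single leaf, because [full_neighbor]
   identifies its leaf edges with the edge at [y]. *)
have [/exists_inP[x xL /third_vertexP[y [e [fy U eE [xe ye ve]]]]]|nofull] :=
    boolP [exists x in leaves v, third_vertex full x v].
  have /and3P[xy xv yv] : [&& x != y, x != v & y != v] by rewrite -uniq3E.
  have sub : leaves v \subset [set x].
    apply/subsetP=> p; rewrite !inE => /and3P[_ /eqP dp /adjacentP[f [fE pf vf]]].
    have vy : v != y by rewrite eq_sym.
    have fe := full_neighbor fy eE ye ve vy fE vf pf dp.
    rewrite fe in pf; case/or3P: (edge_cover eE U xe ye ve pf) => // /eqP pE.
      by case/andP: fy; rewrite -pE dp.
    by rewrite -pE dp in hv.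
  apply: leq_trans (_ : 4 + 2 <= _); last first.
    by do 3!apply: leq_trans (leq_addr _ _); rewrite (leq_mul2l 2 3) hv.
  rewrite leq_add2l; apply: leq_trans (_ : #|leaves v| * 2 <= _).
    by rewrite -sum_nat_const; apply: leq_sum => p _; apply: charge_le2.
  by rewrite (leq_mul2r 2 _ 1) -(cards1 x) subset_leq_card.
(* Here each leaf costs at most 1, some edge at [v] has no leaf, and d - 1 <= 2d - 4 for d >= 3. *)
have : \sum_(x in leaves v) charge x v <= #|leaves v| * 1.
  rewrite -sum_nat_const; apply: leq_sum => x xL; rewrite /charge lowF //.
  have /negPf-> : ~~ third_vertex full x v.
    by apply: contra nofull => ?; apply/exists_inP; exists x.
  by do !case: ifP.
by lia.
Qed.

(** Summing [charge_bound] and cancelling the refunds against [sum_charge] leaves 4n <= 6e + 2(|K| +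
    |F|). *)
Lemma edges_ge_min_degree1 : 2 * #|vertices H| <= 3 * #|edges H| + 6.
Proof.
pose K := [set v in vertices H | core v].
pose F := [set v in vertices H | core v && full v].
pose D := [set v in vertices H | degree H v == 1].
(* Either there is no full core and the clique bound gives 5, or a full core is the only core and
   the sum is at most 2. *)
have KF : #|K| + #|F| <= 6.
  have K5 : #|K| <= 5.
    apply: card_clique_le5 => z w; rewrite !inE => /andP[_ cz] /andP[_ cw].
    exact: core_adjacent.
  have [->|/set0Pn[v]] := eqVneq F set0; first by rewrite cards0; lia.
  rewrite inE => /and3P[vV cv fv].
  have sub : K \subset [set v].
    by apply/subsetP=> z; rewrite !inE => /andP[_ cz]; rewrite (core_full cz cv fv).
  have sub' : F \subset K by apply/subsetP=> z; rewrite !inE => /and3P[-> ->].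
  have := subset_leq_card sub; have := subset_leq_card sub'; rewrite cards1; lia.
have count (P : pred T) : \sum_(v in vertices H) 2 * P v = 2 * #|[set v in vertices H | P v]|.
  rewrite -big_distrr -sum1_card -big_mkcondr /=; congr (2 * _).
  by apply: eq_bigl => v; rewrite inE.
have : \sum_(v in vertices H) (4 + \sum_(x in vertices H | degree H x == 1) charge x v) <=
  \sum_(v in vertices H)
    (2 * degree H v + 2 * core v + 2 * (core v && full v) + 2 * (degree H v == 1)).
  by apply: leq_sum => v; apply: charge_bound.
have -> : \sum_(v in vertices H)
    (2 * degree H v + 2 * core v + 2 * (core v && full v) + 2 * (degree H v == 1)) =
    2 * (3 * #|edges H|) + 2 * #|K| + 2 * #|F| + 2 * #|D|.
  rewrite -sum_degree big_distrr -(count core) -(count (fun v => core v && full v)).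
  by rewrite -(count (fun v => degree H v == 1)) -!big_split.
rewrite big_split sum_nat_const exchange_big /=.
have : \sum_(x in vertices H | degree H x == 1) 2 <=
    \sum_(x in vertices H | degree H x == 1) \sum_(v in vertices H) charge x v.
  by apply: leq_sum => x /andP[xV /eqP]; apply: sum_charge.
rewrite -/K -/F -/D (_ : \sum_(x in vertices H | degree H x == 1) 2 = 2 * #|D|); first by lia.
by rewrite mulnC -sum_nat_const; apply: eq_bigl => v; rewrite inE.
Qed.

End Linear.

(** * Breadth-first search from a vertex of degree 2 *)

Section Moore.

Variables (T : finType) (H : hypergraph T).
Hypothesis unif : uniform 3 H.
Hypothesis tight : {in vertices H &, forall x y, x != y ->
  adjacent H x y \/ linked3 H x y}.
Hypothesis deg_gt1 : {in vertices H, forall v, 1 < degree H v}.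

(** The closed neighbourhood of [v], provided that [v] lies on an edge. *)
Definition link v := cover [set e in edges H | v \in e].

Lemma link_edge e v : e \in edges H -> v \in e -> e \subset link v.
Proof. by move=> eE ve; apply: (bigcup_sup e); rewrite // inE eE. Qed.

Lemma linkP v w : reflect (exists e, [/\ e \in edges H, v \in e & w \in e]) (w \in link v).
Proof.
apply: (iffP bigcupP) => [[e]|[e [eE ve we]]].
  by rewrite inE => /andP[eE ve] we; exists e.
by exists e; rewrite ?inE ?eE.
Qed.

Lemma card_bigcup_leq (I : finType) (A : {set I}) (F : I -> {set T}) :
  #|\bigcup_(i in A) F i| <= \sum_(i in A) #|F i|.
Proof.
elim/big_rec2: _ => [|i n B _ le]; first by rewrite cards0.
by apply: leq_trans (leq_card_setU _ _).1 _; rewrite leq_add2l.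
Qed.

Lemma card_star_outside v (S : {set {set T}}) :
  S \subset [set e in edges H | v \in e] -> #|cover S :\ v| <= 2 * #|S|.
Proof.
move=> sS; rewrite /cover.
have -> : (\bigcup_(e in S) e) :\ v = \bigcup_(e in S) (e :\ v).
  apply/setP=> w; rewrite !inE; apply/andP/bigcupP => [[wv /bigcupP[e eS we]]|[e eS]].
    by exists e; rewrite // !inE wv.
  by rewrite !inE => /andP[wv we]; split=> //; apply/bigcupP; exists e.
apply: leq_trans (card_bigcup_leq _ _) _.
rewrite mulnC -sum_nat_const; apply: leq_sum => e /(subsetP sS).
rewrite inE => /andP[eE ve].
by have := cardsD1 v e; rewrite ve (unif eE); case: #|_| => [|[|[]]].
Qed.

(* One step of breadth-first search: the parent edge of [v] yields nothing new. *)
Lemma card_link_new v e (A : {set T}) : e \in edges H -> v \in e -> e \subset A ->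
  #|link v :\: A| <= 2 * (degree H v).-1.
Proof.
move=> eE ve eA; pose S := [set f in edges H | v \in f] :\ e.
have cardS : #|S| = (degree H v).-1.
  by rewrite /degree (cardsD1 e [set f in edges H | v \in f]) inE eE ve.
rewrite -cardS; apply: leq_trans (card_star_outside (subD1set _ e)).
apply: subset_leq_card; apply/subsetP=> w; rewrite inE => /andP[wA /linkP[f [fE vf wf]]].
rewrite 2!inE; apply/andP; split; first by apply: contraNneq wA => ->; apply: (subsetP eA).
apply/bigcupP; exists f => //; rewrite /S !inE fE vf !andbT.
by apply: contraNneq wA => fe; apply: (subsetP eA); rewrite -fe.
Qed.

(** Each vertex of the layer [N] has a parent edge inside the explored set [A], so [card_link_new]
    applies to each. *)
Lemma card_layer (N A : {set T}) :
  (forall v, v \in N -> exists e, [/\ e \in edges H, v \in e & e \subset A]) ->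
  #|(\bigcup_(v in N) link v) :\: A| <= \sum_(v in N) 2 * (degree H v).-1.
Proof.
move=> parent.
have -> : (\bigcup_(v in N) link v) :\: A = \bigcup_(v in N) (link v :\: A).
  apply/setP=> w; rewrite !inE; apply/andP/bigcupP => [[wA /bigcupP[v vN wv]]|[v vN]].
    by exists v; rewrite // inE wA.
  by rewrite inE => /andP[wA wv]; split=> //; apply/bigcupP; exists v.
apply: leq_trans (card_bigcup_leq _ _) _; apply: leq_sum => v /parent[e [eE ve eA]].
exact: card_link_new eE ve eA.
Qed.

(** With all degrees 2 the layers have at most 1, 4, 8 and 16 vertices, 29 in all. A unit of excess
    degree in the first layer adds at most 2 + 4 vertices further out, and one in the second layer
    at most 2. *)
Lemma moore_bound x : x \in vertices H -> degree H x = 2 ->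
  #|vertices H| <= 29 + 6 * \sum_(v in vertices H) (degree H v - 2).
Proof.
move=> xV dx; have dE v : v \in vertices H -> 2 * (degree H v).-1 = 2 + 2 * (degree H v - 2).
  by move=> /deg_gt1; lia.
have linkV v : link v \subset vertices H.
  by apply/subsetP=> w /linkP[e [eE _ we]]; apply: (edge_vertex eE we).
pose N1 := link x :\ x.
pose A2 := link x :|: \bigcup_(v in N1) link v; pose N2 := A2 :\: link x.
pose A3 := A2 :|: \bigcup_(v in N2) link v.
have xl : x \in link x.
  have /set0Pn[e] : [set e in edges H | x \in e] != set0.
    by rewrite -card_gt0 -/(degree H x) dx.
  by rewrite inE => /andP[eE xe]; apply/linkP; exists e.
have N1V : N1 \subset vertices H by apply: subset_trans (subD1set _ _) (linkV x).
have A2V : A2 \subset vertices H.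
  by rewrite subUset linkV; apply/bigcupsP=> v _; apply: linkV.
have N2V : N2 \subset vertices H by apply: subset_trans (subsetDl _ _) A2V.
have card1 : #|N1| <= 4.
  by have := card_star_outside (subxx [set e in edges H | x \in e]); rewrite -/(degree H x) dx.
have card2 : #|N2| <= \sum_(v in N1) 2 * (degree H v).-1.
  rewrite /N2 /A2 setDUl setDv set0U; apply: card_layer => v.
  rewrite 2!inE => /andP[vx /linkP[e [eE xe ve]]].
  by exists e; split=> //; apply: link_edge.
have card3 : #|A3 :\: A2| <= \sum_(v in N2) 2 * (degree H v).-1.
  rewrite /A3 setDUl setDv set0U; apply: card_layer => v.
  rewrite !inE => /andP[vx /orP[|/bigcupP[u uN /linkP[e [eE ue ve]]]]].
    by rewrite (negPf vx).
  exists e; split=> //; apply: subset_trans (link_edge eE ue) _.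
  by apply: subset_trans (subsetUr _ _); apply: bigcup_sup.
have step w a b e : e \in edges H -> a \in e -> b \in e -> forall B : {set T}, w = b ->
    a \in B -> w \in \bigcup_(v in B) link v.
  by move=> eE ae be B -> aB; apply/bigcupP; exists a => //; apply/linkP; exists e.
(* By [tight], the search is exhausted after three steps. *)
have sub : vertices H \subset A3.
  apply/subsetP=> v vV; rewrite inE; apply/orP.
  have [vA|vA] := boolP (v \in A2); [by left | right].
  have [vx|vx] := eqVneq v x; first by case/negP: vA; rewrite vx inE xl.
  move: vx; rewrite eq_sym => /(tight xV vV)[/adjacentP[e mem]|].
    by case/negP: vA; rewrite inE; apply/orP; left; apply/linkP; exists e.
  move=> [a [b [e [f [g [Uv _ [eE fE gE] [xe ae af bf] [bg vg]]]]]]].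
  have aN : a \in N1.
    move: Uv; rewrite uniq4E => /andP[xa _]; rewrite !inE eq_sym xa.
    by apply/linkP; exists e.
  have bA : b \in A2 by rewrite inE (step b a b f) ?orbT.
  apply: (step v b v g) => //; rewrite inE bA andbT; apply: contraNN vA => bl.
  have [bx|bx] := eqVneq b x.
    by rewrite inE; apply/orP; left; apply/linkP; exists g; rewrite -bx.
  by rewrite inE (step v b v g) ?orbT // !inE bx.
have cardA3 : #|vertices H| <= 1 + #|N1| + #|N2| + #|A3 :\: A2|.
  have -> : 1 + #|N1| = #|link x| by rewrite (cardsD1 x (link x)) xl.
  apply: leq_trans (subset_leq_card sub) _.
  have := cardsID (link x) A2; have := cardsID A2 A3.
  by rewrite (setIidPr (subsetUl _ _)) => <-; rewrite (setIidPr (subsetUl _ _)) => <-.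
have split (N : {set T}) : N \subset vertices H ->
    \sum_(v in N) 2 * (degree H v).-1 = 2 * #|N| + 2 * \sum_(v in N) (degree H v - 2).
  move=> NV; rewrite (mulnC 2 #|N|) -sum_nat_const big_distrr -big_split /=.
  by apply: eq_bigr => v /(subsetP NV)/dE.
rewrite split // in card2; rewrite split // in card3.
have excess : \sum_(v in N1) (degree H v - 2) + \sum_(v in N2) (degree H v - 2) <=
    \sum_(v in vertices H) (degree H v - 2).
  have disj : N2 \subset vertices H :\: N1.
    apply/subsetP=> w wN2; rewrite inE (subsetP N2V) // andbT.
    by move: wN2; rewrite !inE => /andP[/negPf-> _]; rewrite andbF.
  rewrite [leqRHS](big_setID N1) /= (setIidPr N1V) leq_add2l.
  by rewrite [leqRHS](big_setID N2) /= (setIidPr disj) leq_addr.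
clear -card1 card2 card3 cardA3 excess; lia.
Qed.
End Moore.

(** * What saturation says about components *)

Section Components.

Variables (T : finType) (H : hypergraph T).
Hypotheses (unif : uniform 3 H) (lin : linear_hypergraph H).
Hypotheses (sat : linear_berge_saturated 4 H).

Implicit Types (x y z u v w : T) (e f g : {set T}).

Local Notation conn := (connect (adjacent H)).

Lemma conn_sym : connect_sym (adjacent H).
Proof. exact/sym_connect_sym/adjacent_sym. Qed.

Lemma conn_edge e x y : e \in edges H -> x \in e -> y \in e -> conn x y.
Proof. by move=> eE xe ye; apply/connect1/adjacentP; exists e. Qed.

Lemma linked3_sym x y : linked3 H x y -> linked3 H y x.
Proof.
move=> [a [b [e [f [g [Uv Ue [eE fE gE] [xe ae af bf] [bg yg]]]]]]].
exists b, a, g, f, e; split=> //.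
  by move: Uv; rewrite -(rev_uniq [:: x; a; b; y]).
by move: Ue; rewrite -(rev_uniq [:: e; f; g]).
Qed.

Lemma linked3_conn x y : linked3 H x y -> conn x y.
Proof.
move=> [a [b [e [f [g [_ _ [eE fE gE] [xe ae af bf] [bg yg]]]]]]].
apply: connect_trans (conn_edge eE xe ae) _.
exact: connect_trans (conn_edge fE af bf) (conn_edge gE bg yg).
Qed.

(** The triple can be added without losing linearity, so saturation yields a C4. This cycle uses the
    triple, and its other three edges link two vertices of it. *)
Lemma independent_triple x y z :
  x \in vertices H -> y \in vertices H -> z \in vertices H ->
  uniq [:: x; y; z] ->
  ~~ adjacent H x y -> ~~ adjacent H x z -> ~~ adjacent H y z ->
  exists u v, [/\ u \in [set x; y; z], v \in [set x; y; z], u != v & linked3 H u v].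
Proof.
move=> xV yV zV U nxy nxz nyz; set t := [set x; y; z].
have /and3P[xy xz yz] : [&& x != y, x != z & y != z] by rewrite -uniq3E.
have tV : t \subset vertices H by apply/subsetP=> w; rewrite !inE -orbA => /or3P[] /eqP->.
have nadj u v : u \in t -> v \in t -> u != v -> ~~ adjacent H u v.
  rewrite !inE -!orbA => /or3P[] /eqP-> /or3P[] /eqP-> //; rewrite ?eqxx // => _;
    by rewrite // adjacent_sym.
have one e : e \in edges H -> #|t :&: e| <= 1.
  move=> eE; rewrite leqNgt; apply/negP=> /card_gt1P[u [v [ut vt uv]]].
  move: ut vt; rewrite !in_setI => /andP[ut ue] /andP[vt ve].
  by case/negP: (nadj u v ut vt uv); apply/adjacentP; exists e.
have card_t : #|t| = 3 by rewrite /t -setUA cardsU1 cards2 !inE negb_or xy xz yz.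
have tE : t \notin edges H.
  by apply/negP=> /one; rewrite setIid card_t.
have lin_t : linear_hypergraph (add_edge H t).
  move=> e f; rewrite !inE => /orP[/eqP->|eE] /orP[/eqP->|fE] ef.
  - by rewrite eqxx in ef.
  - exact: one.
  - by rewrite setIC; apply: one.
  - exact: lin.
have [noC4 /(_ t tV card_t tE lin_t)[v [e [vI eI cyc]]]] := sat.
have [i ei] : exists i, e i = t.
  case: (pickP (fun i => e i == t)) => [i /eqP ei|ne]; first by exists i.
  case: noC4; exists v, e; split=> // i; have [eE vi vi'] := cyc i; split=> //.
  by move: eE; rewrite !inE ne.
have eE j : j != i -> e j \in edges H.
  move=> ji; have [] := cyc j; rewrite !inE => /orP[/eqP ej|//].
  by case/eqP: ji; apply: eI; rewrite ej.
exists (v (ordS i)), (v i); have [_ vi vi'] := cyc i; rewrite ei in vi vi'.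
split=> //; first by rewrite (inj_eq vI); case: i {ei eE vi vi'} => [[|[|[|[|]]]]].
have S4 : ordS (ordS (ordS (ordS i))) = i.
  by apply: val_inj; case: i {ei eE vi vi'} => [[|[|[|[|]]]]].
exists (v (ordS (ordS i))), (v (ordS (ordS (ordS i)))).
exists (e (ordS i)), (e (ordS (ordS i))), (e (ordS (ordS (ordS i)))).
have [_ c1 c1'] := cyc (ordS i); have [_ c2 c2'] := cyc (ordS (ordS i)).
have [_ c3 c3'] := cyc (ordS (ordS (ordS i))); rewrite S4 in c3'.
split=> //.
- rewrite uniq4E !(inj_eq vI).
  by case: i {ei eE vi vi' S4 c1 c1' c2 c2' c3 c3'} => [[|[|[|[|]]]]].
- rewrite uniq3E !(inj_eq eI).
  by case: i {ei eE vi vi' S4 c1 c1' c2 c2' c3 c3'} => [[|[|[|[|]]]]].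
- by split; apply: eE; case: i {ei vi vi' S4 c1 c1' c2 c2' c3 c3'} => [[|[|[|[|]]]]].
Qed.

Definition component x := [set y in vertices H | conn x y].

Lemma component_closed x e v w :
  v \in component x -> e \in edges H -> v \in e -> w \in e -> w \in component x.
Proof.
rewrite !inE => /andP[_ xv] eE ve we; rewrite (edge_vertex eE we) /=.
exact: connect_trans xv (conn_edge eE ve we).
Qed.

Lemma component_edge x e v : v \in component x -> e \in edges H -> v \in e ->
  e \in edges (induced H (component x)).
Proof.
move=> vC eE ve; rewrite inE eE; apply/subsetP=> w; exact: component_closed vC eE ve.
Qed.

(** Nonadjacent [u] and [v] form an independent triple with the outside vertex [o]. Linked vertices
    are connected, so the linked pair is [u], [v], and the path stays in the component. *)
Lemma component_tight x o : o \in vertices H -> ~~ conn x o ->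
  {in component x &, forall u v, u != v ->
    adjacent (induced H (component x)) u v \/ linked3 (induced H (component x)) u v}.
Proof.
move=> oV xo u v uC vC uv.
have out w : w \in component x -> ~~ conn w o /\ w != o.
  rewrite inE => /andP[_ xw]; split; last by apply: contraNneq xo => <-.
  by apply: contraNN xo; apply: connect_trans.
have [/adjacentP[e [eE ue ve]]|nuv] := boolP (adjacent H u v).
  by left; apply/adjacentP; exists e; rewrite (component_edge uC eE ue).
right.
have sub : linked3 H u v -> linked3 (induced H (component x)) u v.
  move=> [a [b [e [f [g [Uv Ue [eE fE gE] [ue ae af bf] [bg vg]]]]]]].
  exists a, b, e, f, g; split=> //; split.
  - exact: component_edge uC eE ue.
  - exact: component_edge (component_closed uC eE ue ae) fE af.
  - exact: component_edge vC gE vg.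
apply: sub.
have [uo uo'] := out u uC; have [vo vo'] := out v vC.
have uV : u \in vertices H by move: uC; rewrite inE => /andP[].
have vV : v \in vertices H by move: vC; rewrite inE => /andP[].
have [||||a [b [at_ bt ab lab]]] := independent_triple uV vV oV.
- by rewrite uniq3E uv uo' vo'.
- by [].
- by apply: contraNN uo; apply: connect1.
- by apply: contraNN vo; apply: connect1.
have lc := linked3_conn lab.
have ou : ~~ conn o u by rewrite conn_sym.
have ov : ~~ conn o v by rewrite conn_sym.
move: at_ bt ab lab lc; rewrite !inE -!orbA.
move=> /or3P[] /eqP-> /or3P[] /eqP->; rewrite ?eqxx //.
- by move=> _ _; rewrite (negPf uo).
- by move=> _ /linked3_sym.
- by move=> _ _; rewrite (negPf vo).
- by move=> _ _; rewrite (negPf ou).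
- by move=> _ _; rewrite (negPf ov).
Qed.

(** Vertices from three components would form an independent triple without a linked pair. *)
Lemma two_components x o w : x \in vertices H -> o \in vertices H -> ~~ conn x o ->
  w \in vertices H -> (w \in component x) || (w \in component o).
Proof.
move=> xV oV xo wV; rewrite !inE wV /=; apply: contraT; rewrite negb_or => /andP[xw ow].
have na a b : ~~ conn a b -> ~~ adjacent H a b by apply: contraNN; apply: connect1.
have ne a b : ~~ conn a b -> a != b by apply: contraNneq => ->.
have [||||a [b [at_ bt ab /linked3_conn lab]]] := independent_triple xV oV wV.
- by rewrite uniq3E !ne.
- exact: na.
- exact: na.
- exact: na.
move: at_ bt ab lab; rewrite !inE -!orbA.
move=> /or3P[] /eqP-> /or3P[] /eqP->; rewrite ?eqxx // => _.
- by rewrite (negPf xo).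
- by rewrite (negPf xw).
- by rewrite conn_sym (negPf xo).
- by rewrite (negPf ow).
- by rewrite conn_sym (negPf xw).
- by rewrite conn_sym (negPf ow).
Qed.

Lemma induced_uniform C : uniform 3 (induced H C).
Proof. by move=> e; rewrite inE => /andP[/unif]. Qed.

Lemma induced_linear C : linear_hypergraph (induced H C).
Proof. by move=> e f; rewrite !inE => /andP[eE _] /andP[fE _]; apply: lin. Qed.

Lemma induced_no_berge C l : ~ has_berge_cycle l H -> ~ has_berge_cycle l (induced H C).
Proof.
move=> no [v [e [vI eI cyc]]]; apply: no; exists v, e; split=> // i.
by have [] := cyc i; rewrite inE => /andP[].
Qed.

End Components.

(** * Edge bounds for one component *)

Section Bounds.

Variables (T : finType) (H : hypergraph T).
Hypotheses (unif : uniform 3 H) (lin : linear_hypergraph H).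
Hypothesis noC4 : ~ has_berge_cycle 4 H.
Hypothesis tight : {in vertices H &, forall x y, x != y ->
  adjacent H x y \/ linked3 H x y}.
Hypothesis nonempty : vertices H != set0.

(** For at most 3 vertices the constant 6 suffices, which includes an isolated vertex; otherwise
    [tight] puts every vertex on an edge. *)
Lemma edges_lower_bound : 2 * #|vertices H| <= 3 * #|edges H| + 6.
Proof.
have [n3|n4] := leqP #|vertices H| 3.
  by apply: leq_trans (leq_addl _ _); rewrite (leq_mul2l 2 _ 3).
have deg_gt0 : {in vertices H, forall v, 0 < degree H v}.
  move=> v vV; rewrite lt0n; apply/eqP=> d0.
  have noedge e : e \in edges H -> v \in e -> False.
    move=> eE ve; move/eqP: d0; rewrite cards_eq0 => /eqP/setP/(_ e).
    by rewrite !inE eE ve.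
  have /subsetPn[w wV] : ~~ (vertices H \subset [set v]).
    by apply: contraL n4 => /subset_leq_card; rewrite cards1 -leqNgt => /leq_trans; apply.
  rewrite inE eq_sym => /(tight vV wV)[/adjacentP[e [eE ve _]]|]; first exact: noedge eE ve.
  by move=> [a [b [e [f [g [_ _ [eE _ _] [ve _ _ _] _]]]]]]; apply: noedge eE ve.
exact: edges_ge_min_degree1.
Qed.

(** The total excess over degree 2 is 3e - 2n, so [moore_bound] reads n <= 29 + 6(3e - 2n). *)
Lemma edges_ge_min_degree2 : min_degree H = 2 ->
  13 * #|vertices H| <= 18 * #|edges H| + 29.
Proof.
have [[x xV dx] lb] := min_degreeP nonempty; move=> d2; rewrite d2 in dx lb.
have := moore_bound unif tight lb xV dx; have := sum_degree unif.
have -> : \sum_(v in vertices H) degree H v =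
    \sum_(v in vertices H) (degree H v - 2) + #|vertices H| * 2.
  by rewrite -sum_nat_const -big_split; apply: eq_bigr => v /lb le; rewrite /= subnK.
by lia.
Qed.

Lemma edges_ge_min_degree3 : 2 < min_degree H -> #|vertices H| <= #|edges H|.
Proof.
have [_ lb] := min_degreeP nonempty; move=> d3.
rewrite -(leq_pmul2l (isT : 0 < 3)) -(sum_degree unif) mulnC -sum_nat_const.
by apply: leq_sum => v /lb; apply: leq_trans.
Qed.

End Bounds.

(** * The bounds over the rationals, and the sum over two components *)

Import Order.TTheory GRing.Theory Num.Theory.
Local Open Scope ring_scope.

Theorem theorem1p5 (T : finType) (H : hypergraph T)
    (H_order : (6 <= #|vertices H|)%N)
    (H_uniform : uniform 3 H)
    (H_linear : linear_hypergraph H)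
    (H_saturated : linear_berge_saturated 4 H)
    (H_disconnected : ~ connected H) :
  (forall H' : hypergraph T, is_component H H' ->
     let n' : rat := #|vertices H'|%:R in
     let e' : rat := #|edges H'|%:R in
     [/\ min_degree H' = 0%N -> 0 <= e',
         min_degree H' = 1%N -> 2 * n' / 3 - 2 <= e',
         min_degree H' = 2%N -> (13 * n' - 29) / 18 <= e' &
         (3 <= min_degree H')%N -> n' <= e'])
  /\ 2 * (#|vertices H|%:R : rat) / 3 - 4 <= #|edges H|%:R.
Proof.
(* If every vertex were reachable from [x], then [H] would be connected. *)
have outside x : x \in vertices H ->
    exists2 o, o \in vertices H & ~~ connect (adjacent H) x o.
  move=> xV; apply/exists_inP; apply: contra_notT H_disconnected.
  rewrite negb_exists_in => /forall_inP xall u v /xall xu /xall xv.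
  rewrite negbK in xu; rewrite negbK in xv.
  by apply: connect_trans xv; rewrite conn_sym.
have compP x : x \in vertices H -> let C := induced H (component H x) in
    [/\ vertices C != set0, uniform 3 C, linear_hypergraph C, ~ has_berge_cycle 4 C &
        {in vertices C &, forall u v, u != v -> adjacent C u v \/ linked3 C u v}].
  move=> xV; have [o oV xo] := outside x xV; split.
  - by apply/set0Pn; exists x; rewrite inE xV connect0.
  - exact: induced_uniform.
  - exact: induced_linear.
  - by apply: induced_no_berge; case: H_saturated.
  - exact: component_tight xo.
split.
  move=> H' [x xV ->] /=.
  have /= [ne unifC linC noC4C tightC] := compP x xV.
  split=> [_|_|d2|d3]; first exact: ler0n.
  - have := edges_lower_bound unifC linC noC4C tightC.
    by rewrite -(ler_nat rat) natrD !natrM; lra.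
  - have := edges_ge_min_degree2 unifC tightC ne d2.
    by rewrite -(ler_nat rat) natrD !natrM; lra.
  - by rewrite ler_nat; apply: edges_ge_min_degree3 unifC ne d3.
have [x xV] : exists x, x \in vertices H.
  by apply/set0Pn; rewrite -card_gt0; apply: leq_trans H_order.
have [o oV xo] := outside x xV.
have /= [_ unif1 lin1 noC41 tight1] := compP x xV.
have /= [_ unif2 lin2 noC42 tight2] := compP o oV.
have lb1 := edges_lower_bound unif1 lin1 noC41 tight1.
have lb2 := edges_lower_bound unif2 lin2 noC42 tight2.
have vle : (#|vertices H| <= #|component H x| + #|component H o|)%N.
  apply: leq_trans (leq_card_setU _ _).1; apply: subset_leq_card.
  by apply/subsetP=> w wV; rewrite in_setU two_components.
have ele : (#|edges (induced H (component H x))| +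
    #|edges (induced H (component H o))| <= #|edges H|)%N.
  (* A common edge is nonempty and would connect [x] to [o]. *)
  have disj : edges (induced H (component H x)) :&: edges (induced H (component H o)) = set0.
    apply/setP=> e; rewrite !inE; apply/negP.
    move=> /andP[/andP[eE /subsetP e1] /andP[_ /subsetP e2]].
    have /set0Pn[v ve] : e != set0 by rewrite -card_gt0 H_uniform.
    move: (e1 v ve) (e2 v ve); rewrite !inE => /andP[_ xv] /andP[_ ov].
    by case/negP: xo; apply: connect_trans xv _; rewrite conn_sym.
  rewrite -cardsUI disj cards0 addn0.
  by apply: subset_leq_card; apply/subsetP=> e; rewrite !inE => /orP[] /andP[].
(* Each of the two components contributes 6, and 12 / 3 is the constant 4. *)
have : (2 * #|vertices H| <= 3 * #|edges H| + 12)%N.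
  by move: vle ele lb1 lb2; clear; rewrite /=; lia.
by rewrite -(ler_nat rat) natrD !natrM; lra.
Qed.
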